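(* Let $A\subset\mathbb{Z}[x]$ be a finite set of nonzero polynomials all of whose roots are real, and let $\lambda_A=\inf_\mu\int x\,d\mu(x)$, where $\mu$ ranges over the Borel probability measures supported on $\mathbb{R}^+$ with $I(\mu)\ge0$ and $\int\log|Q(x)|\,d\mu(x)\ge 0$ for every $Q\in A$. Then $\lambda_A\le\lambda^{SSS}$.
   Context: $\mathbb{R}^+=[0,\infty)$, and $I(\mu)=\iint\log|x_1-x_2|\,d\mu(x_1)\,d\mu(x_2)$ is the logarithmic energy. For an algebraic integer $\alpha$ of degree $n$ with Galois conjugates $\alpha_1,\dots,\alpha_n$, set $\overline{\mathrm{tr}}(\alpha)=\frac1n\sum_{i=1}^n\alpha_i$. The algebraic integer $\alpha$ is totally positive if all $\alpha_i$ are real and $>0$. Let $\mathcal{A}$ be the (countably infinite) set of totally positive algebraic integers. Then $\lambda^{SSS}=\liminf_{\alpha\in\mathcal{A}}\overline{\mathrm{tr}}(\alpha)$, the liminf being taken along any fixed enumeration of $\mathcal{A}$ (it does not depend on the enumeration). *)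

(* Defs.v *)
From HB Require Import structures.
From mathcomp Require Import all_boot all_order all_algebra.
From mathcomp Require Import complex.
From mathcomp Require Import all_classical all_reals all_analysis.

Set Implicit Arguments.
Unset Strict Implicit.
Unset Printing Implicit Defensive.

Import Order.TTheory GRing.Theory Num.Theory.
Import numFieldNormedType.Exports.

Local Open Scope classical_set_scope.
Local Open Scope ring_scope.
Local Open Scope complex_scope.

(* The field of complex numbers is [R[i]], for [R] the real numbers. *)

Definition is_minpolyQ (R : realType) (a : R[i]) (p : {poly rat}) : Prop :=
  [/\ p \is monic, irreducible_poly p & root (map_poly ratr p) a].

(* There is a unique such polynomial when [a] is algebraic over Q; the default
   value 1 is taken only when [a] is transcendental. *)
Definition minpolyQ (R : realType) (a : R[i]) : {poly rat} :=
  xget 1 [set p | is_minpolyQ a p].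

(* The complex roots of the minimal polynomial, listed with multiplicity; the
   size of this sequence is the degree of [a]. *)
Definition conjugates (R : realType) (a : R[i]) : seq R[i] :=
  sval (closed_field_poly_normal (map_poly ratr (minpolyQ a) : {poly R[i]})).

Definition algebraic_integer (R : realType) (a : R[i]) : Prop :=
  integralOver (intr : int -> R[i]) a.

(* In [R[i]], [0 < z] means that [z] is real and positive. *)
Definition totally_positive (R : realType) : set R[i] :=
  [set a | algebraic_integer a /\ forall z, z \in conjugates a -> 0 < z].

Definition trbar (R : realType) (a : R[i]) : R[i] :=
  (\sum_(z <- conjugates a) z) / (size (conjugates a))%:R.

(* [trbar (e k)] is a real number when [e k] is totally positive, so taking its
   real part only changes its type. *)
Definition liminf_trbar (R : realType) (e : nat -> R[i]) : \bar R :=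
  limn_einf (fun k => (complex.Re (trbar (e k)))%:E).

Definition is_enumeration (T : Type) (S : set T) (e : nat -> T) : Prop :=
  set_bij [set: nat] S e.

Definition real_rooted (R : realType) (Q : {poly int}) : Prop :=
  forall z : R[i], root (map_poly intr Q) z -> z \is Num.real.

Local Open Scope ereal_scope.

(* [lne 0 = -oo].  The integral of a function is the difference of the integrals
   of its positive and negative parts, with value -oo when both are +oo; for the
   two integrals below this requires [mu] to have infinite mean. *)
Definition log_energy (R : realType) (mu : probability (measurableTypeR R) R)
    : \bar R :=
  \int[mu \x mu]_z lne (`|z.1 - z.2|%R)%:E.

Definition log_integral (R : realType)
    (mu : probability (measurableTypeR R) R) (Q : {poly int}) : \bar R :=
  \int[mu]_x lne (`|(map_poly intr Q : {poly R}).[x]|%R)%:E.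

Definition admissible (R : realType) (A : set {poly int})
    (mu : probability (measurableTypeR R) R) : Prop :=
  [/\ mu `[0%R, +oo[%classic = 1,
      0 <= log_energy mu
    & forall Q, A Q -> 0 <= log_integral mu Q].

Definition lambda (R : realType) (A : set {poly int}) : \bar R :=
  ereal_inf [set \int[mu]_x x%:E
            | mu in [set mu : probability (measurableTypeR R) R
                    | admissible A mu]].

(* Main.v *)
Require Import Defs.
From mathcomp Require Import all_boot all_order all_algebra.
From mathcomp Require Import complex separable.
From mathcomp Require Import all_classical all_reals all_analysis.
From mathcomp Require Import measurable_realfun ring lra.

(** No compactness is needed: an admissible measure of mean close to the liminf
    can be written down. Multiply many distinct minimal polynomials of totally
    positive integers of small mean trace into a squarefree monic integer
    polynomial P with roots x_1, ..., x_n, chosen such that no Q in A vanishes at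
    a root. The discriminant of P and its resultants with the Q in A are
    nonzero integers, so that
      sum_(i <> j) log |x_i - x_j| >= 0  and  sum_i log |Q(x_i)| >= 0.
    Replace each x_i by the uniform measure on [x_i, x_i + r]. The logarithmic
    potentials decrease by an amount controlled by a small multiple of
    log^- |x - y| + |x - y| + 1, hence the averaged inequalities above survive up
    to a small error, and the diagonal terms contribute O(log (1/r) / n). Mixing
    in a small multiple of the uniform measure on [M, 2M], whose potential is at
    least 1 everywhere for M = e^9, absorbs the errors at a small cost in the
    mean. *)

Set Implicit Arguments.
Unset Strict Implicit.
Unset Printing Implicit Defensive.

Import Order.TTheory GRing.Theory Num.Theory.
Import numFieldNormedType.Exports.

Local Open Scope classical_set_scope.
Local Open Scope ring_scope.
Local Open Scope complex_scope.

(** * Integrality of resultants and discriminants *)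

Lemma ln_norm_prod (R : realType) (I : eqType) (s : seq I) (F : I -> R) :
  (forall i, i \in s -> F i != 0) ->
  ln `|\prod_(i <- s) F i| = \sum_(i <- s) ln `|F i|.
Proof.
move=> F0.
(* Positivity is carried through the induction because [lnM] asks for it. *)
have [//] : (0 < `|\prod_(i <- s) F i| /\
  ln `|\prod_(i <- s) F i| = \sum_(i <- s) ln `|F i|).
elim: s F0 => [|i s IH] F0; first by rewrite !big_nil normr1 ln1 ltr01.
have [|p0 pE] := IH; first by move=> j js; rewrite F0// inE js orbT.
have i0 : (0 < `|F i|)%R by rewrite normr_gt0 F0// mem_head.
by rewrite !big_cons normrM mulr_gt0// lnM ?posrE// pE.
Qed.

(* The product is [det (Q (C))] for the companion matrix [C] of [p], which the
   Vandermonde matrix of the roots of [p] diagonalizes. *)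
Lemma prod_horner_intr (F : fieldType) (n : nat) (x : 'I_n -> F)
    (p Q : {poly int}) :
  map_poly intr p = \prod_i ('X - (x i)%:P) -> injective x ->
  exists k : int, \prod_i (map_poly intr Q).[x i] = k%:~R.
Proof.
case: n x => [|n] x pE xI; first by exists 1; rewrite big_ord0.
pose C : 'M[int]_n.+1 := \matrix_(i, j)
  (if i == ord_max then - p`_j else (i.+1 == j :> nat)%:R).
pose d : 'rV[F]_n.+1 := \row_i x i.
pose V := Vandermonde n.+1 d.
have VE i j : V i j = x j ^+ i by rewrite !mxE.
have xp j : x j ^+ n.+1 = - \sum_(k < n.+1) (p`_k)%:~R * x j ^+ k.
  have mp : \prod_i ('X - (x i)%:P) \is monic by exact: monic_prod_XsubC.
  have sp : size (\prod_i ('X - (x i)%:P)) = n.+2.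
    by rewrite size_prod_XsubC /index_enum unlock -enumT size_enum_ord.
  have : (map_poly intr p).[x j] = 0.
    by rewrite pE horner_prod (bigD1 j)//= hornerXsubC subrr mul0r.
  rewrite horner_coef pE sp big_ord_recr/= -pE => /eqP.
  have -> : (map_poly intr p)`_n.+1 = 1 :> F.
    by rewrite pE; move/monicP: mp; rewrite lead_coefE sp.
  rewrite mul1r addrC addr_eq0 => /eqP ->; congr (- _).
  by apply: eq_bigr => k _; rewrite coef_map_id0.
(* The powers of [x j] form an eigenvector of [C] for the eigenvalue [x j]: the upper rows shift the
   powers, and the last row is [xp]. *)
have CV : map_mx intr C *m V = V *m diag_mx d.
  apply/matrixP => i j; rewrite mul_mx_diag !mxE.
  have [->|im] := eqVneq i ord_max.
    rewrite /= -exprSr xp -sumrN; apply: eq_bigr => k _.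
    by rewrite !mxE eqxx rmorphN/= mulNr.
  have i1 : (i.+1 < n.+1)%N.
    rewrite ltn_neqAle ltn_ord andbT; apply: contra im => /eqP/succn_inj/= e.
    exact/eqP/val_inj.
  rewrite (bigD1 (Ordinal i1))//= !mxE (negPf im)/= eqxx mul1r -exprSr.
  rewrite big1 ?addr0// => k ki; rewrite !mxE (negPf im).
  rewrite (_ : (i.+1 == k :> nat) = false) ?mul0r//.
  by apply: contraNF ki => /eqP e; apply/eqP/val_inj.
have Vu : V \in unitmx.
  rewrite unitmxE unitfE det_Vandermonde; apply/prodf_neq0 => i _.
  apply/prodf_neq0 => j ij; rewrite !mxE subr_eq0.
  by apply: contraTneq ij => /xI ->; rewrite ltnn.
have CE : map_mx intr C = V *m diag_mx d *m invmx V by rewrite -CV mulmxK.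
exists (\det (horner_mx C Q)).
rewrite -det_map_mx map_horner_mx CE horner_mx_uconj// horner_mx_diag.
rewrite !det_mulmx mulrAC -det_mulmx mulmxV// det1 mul1r det_diag.
by apply: eq_bigr => i _; rewrite !mxE.
Qed.

Lemma norm_prod_horner_ge1 (F : numFieldType) (n : nat) (x : 'I_n -> F)
    (p Q : {poly int}) :
  map_poly intr p = \prod_i ('X - (x i)%:P) -> injective x ->
  (forall i, (map_poly intr Q).[x i] != 0) ->
  1 <= `|\prod_i (map_poly intr Q).[x i]|.
Proof.
move=> pE xI Q0; have [k kE] := prod_horner_intr Q pE xI.
have : \prod_i (map_poly intr Q).[x i] != 0 by apply/prodf_neq0 => i _.
rewrite kE intr_eq0 -intr_norm ler1z -normr_gt0; exact.
Qed.

Lemma sum_ln_horner_ge0 (R : realType) (n : nat) (x : 'I_n -> R)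
    (p Q : {poly int}) :
  map_poly intr p = \prod_i ('X - (x i)%:P) -> injective x ->
  (forall i, (map_poly intr Q).[x i] != 0) ->
  0 <= \sum_i ln `|(map_poly intr Q).[x i]|.
Proof.
move=> pE xI Q0; rewrite -ln_norm_prod; last by move=> i _.
by rewrite ln_ge0// (norm_prod_horner_ge1 pE).
Qed.

(* The product of the values of [p^`()] at the roots of [p] is the
   discriminant of [p] up to sign. *)
Lemma sum_ln_dist_ge0 (R : realType) (n : nat) (x : 'I_n -> R) (p : {poly int}) :
  map_poly intr p = \prod_i ('X - (x i)%:P) -> injective x ->
  0 <= \sum_i \sum_(j | j != i) ln `|x i - x j|.
Proof.
move=> pE xI.
have xij i j : j != i -> x i - x j != 0.
  by move=> ji; rewrite subr_eq0; apply: contraNneq ji => /xI ->.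
have dE i : (map_poly intr p^`()).[x i] = \prod_(j | j != i) (x i - x j).
  rewrite -deriv_map pE (bigD1 i)//= derivM derivXsubC mul1r.
  rewrite hornerD hornerM hornerXsubC subrr mul0r addr0 horner_prod.
  by apply: eq_bigr => j _; rewrite hornerXsubC.
have d0 i : (map_poly intr p^`()).[x i] != 0.
  by rewrite dE; apply/prodf_neq0 => j; exact: xij.
apply: le_trans (sum_ln_horner_ge0 pE xI d0) _; apply: ler_sum => i _.
rewrite dE -big_filter ln_norm_prod ?big_filter//.
by move=> j; rewrite mem_filter => /andP[/xij].
Qed.

(** * Totally positive algebraic integers *)

Section minpoly.
Context (R : realType).
Implicit Types (a : R[i]).
Local Notation QtoC := (map_poly (ratr : rat -> R[i])).
Local Notation ZtoQ := (map_poly (intr : int -> rat)).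

Lemma map_poly_ratr_intr (F : numFieldType) (q : {poly int}) :
  map_poly (ratr : rat -> F) (map_poly intr q) = map_poly intr q.
Proof.
by rewrite -map_poly_comp; apply: eq_map_poly => k /=; rewrite ratr_int.
Qed.

Lemma map_poly_real_complex_intr (q : {poly int}) :
  map_poly (real_complex R) (map_poly intr q) = map_poly intr q.
Proof.
by rewrite -map_poly_comp; apply: eq_map_poly => k /=; rewrite rmorph_int.
Qed.

(** A nonzero annihilator of least size, made monic, is irreducible: in a factorization one factor
    annihilates [a], so by minimality it has full size. *)
Lemma is_minpolyQ_exists a : algebraic_integer a -> exists p, is_minpolyQ a p.
Proof.
move=> [q qm qa].
pose annih n := `[< exists r : {poly rat},
  [/\ r != 0, root (QtoC r) a & size r = n] >].
have exn : exists n, annih n.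
  exists (size (ZtoQ q)); apply/asboolP; exists (ZtoQ q); split=> //.
    by apply: monic_neq0; exact: monic_map.
  by rewrite map_poly_ratr_intr.
case: (ex_minnP exn) => n /asboolP[r [r0 ra rn]] nmin.
have lr0 : lead_coef r != 0 by rewrite lead_coef_eq0.
have min_size (s : {poly rat}) : s != 0 -> root (QtoC s) a -> (size r <= size s)%N.
  by move=> s0 sa; rewrite rn; apply: nmin; apply/asboolP; exists s.
exists ((lead_coef r)^-1 *: r); split.
- by rewrite monicE lead_coefZ mulVf.
- split.
    rewrite size_scale ?invr_eq0// ltnNge; apply/negP => /size1_polyC rc.
    move: ra r0; rewrite rc map_polyC/= rootC fmorph_eq0 => /eqP ->.
    by rewrite eqxx.
  move=> s s1; rewrite dvdpZr ?invr_eq0// => sr.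
  suff sr' : s %= r.
    by apply: eqp_trans sr' _; rewrite eqp_sym eqp_scale// invr_eq0.
  have [u rE] := dvdpP _ _ sr.
  have [u0 s0] : u != 0 /\ s != 0.
    by apply/andP; rewrite -negb_or -mulf_eq0 -rE.
  have su : (size r = (size u + size s).-1)%N by rewrite rE size_mul.
  have : root (QtoC (u * s)) a by rewrite -rE.
  have us : (0 < size u)%N by rewrite size_poly_gt0.
  have ss : (0 < size s)%N by rewrite size_poly_gt0.
  rewrite rmorphM rootM => /orP[/(min_size _ u0)|/(min_size _ s0)] rus.
    move: rus s1 ss; rewrite su; case: (size s) => [|[|k]]//.
    by rewrite addnS/= addnS ltnNge leq_addr.
  by rewrite -dvdp_size_eqp// eqn_leq rus dvdp_leq.
- by rewrite linearZ/= rootE hornerZ (eqP ra) mulr0.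
Qed.

Lemma minpolyQP a : algebraic_integer a -> is_minpolyQ a (minpolyQ a).
Proof. by move=> /is_minpolyQ_exists[p pa]; exact: (xgetPex 1 (ex_intro _ p pa)). Qed.

Lemma is_minpolyQ_dvdp a (p r : {poly rat}) :
  is_minpolyQ a p -> root (QtoC r) a -> p %| r.
Proof.
move=> [_ [_ pirr] pa] ra; have [cop|ncop] := boolP (coprimep p r).
  have : coprimep (QtoC p) (QtoC r) by rewrite coprimep_map.
  by move=> /coprimep_root/(_ pa); rewrite (eqP ra) eqxx.
have /(_ ncop) := pirr (gcdp p r); rewrite dvdp_gcdl => /(_ isT)/eqp_dvdl <-.
exact: dvdp_gcdr.
Qed.

(** By Gauss's lemma, a rational divisor of a monic integer polynomial is a multiple of an integer
    divisor, whose leading coefficient must be 1 or -1. *)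
Lemma minpolyQ_int a : algebraic_integer a ->
  exists2 p : {poly int}, p \is monic & minpolyQ a = ZtoQ p.
Proof.
move=> ai; have mpa := minpolyQP ai; have [mm _ _] := mpa.
have [q qm qa] := ai.
have : minpolyQ a %| ZtoQ q.
  by apply: is_minpolyQ_dvdp mpa _; rewrite map_poly_ratr_intr.
move=> /dvdpP_rat_int[p [c c0 pE] [r qE]].
have lc1 : lead_coef p * lead_coef r = 1 by rewrite -lead_coefM -qE (monicP qm).
have cl : c * (lead_coef p)%:~R = 1.
  have /monicP := mm; rewrite pE lead_coefZ lead_coef_map_inj//.
  exact: intr_inj.
have pu : lead_coef p \is a GRing.unit by apply/unitrPr; exists (lead_coef r).
have [l1|l1] : lead_coef p = 1 \/ lead_coef p = -1.
  by move: pu; rewrite qualifE/= => /orP[] /eqP; [left|right].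
- exists p; first exact/monicP.
  by move: cl; rewrite pE l1 mulr1 => ->; rewrite scale1r.
- exists (- p); first by apply/monicP; rewrite lead_coefN l1 opprK.
  move: cl; rewrite pE l1 rmorphN1 mulrN1 => /eqP; rewrite eqr_oppLR => /eqP ->.
  by rewrite scaleN1r rmorphN.
Qed.

(** Transfers the complex data to a sequence of reals. The last clause, which later keeps the roots
    away from prescribed polynomials, holds because a polynomial not vanishing at [a] is coprime to
    the irreducible minimal polynomial. *)
Lemma totally_positive_roots a : totally_positive a ->
  exists (p : {poly int}) (xs : seq R),
  [/\ p \is monic, map_poly intr p = \prod_(x <- xs) ('X - x%:P),
     uniq xs & forall x, x \in xs -> 0 < x] /\
  [/\ a \in [seq x%:C | x <- xs],
     complex.Re (trbar a) * (size xs)%:R = \sum_(x <- xs) x &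
     forall G : {poly int}, ~~ root (map_poly intr G) a ->
       forall x, x \in xs -> (map_poly intr G).[x] != 0].
Proof.
move=> [ai apos]; have mpa := minpolyQP ai; have [mm mirr ma] := mpa.
have [p pm mE] := minpolyQ_int ai.
set cs := conjugates a; set xs := map (@complex.Re R) cs.
have csE : QtoC (minpolyQ a) = \prod_(z <- cs) ('X - z%:P).
  rewrite /cs /conjugates; case: closed_field_poly_normal => /= s {1}->.
  by rewrite lead_coef_map (monicP mm) rmorph1 scale1r.
have csR : cs = [seq x%:C | x <- xs].
  rewrite -map_comp -[LHS]map_id; apply/eq_in_map => z zcs /=.
  by rewrite RRe_real// gtr0_real// apos.
have pC : map_poly intr p = \prod_(z <- cs) ('X - z%:P) :> {poly R[i]}.
  by rewrite -map_poly_ratr_intr -mE.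
have pR : map_poly intr p = \prod_(x <- xs) ('X - x%:P) :> {poly R}.
  apply: (map_inj_poly (f := real_complex R)) => //; first exact: complexI.
  rewrite map_poly_real_complex_intr pC csR big_map rmorph_prod/=.
  by apply: eq_bigr => x _; rewrite rmorphB/= map_polyX map_polyC.
exists p, xs; split; split=> //.
(* In characteristic 0 the derivative is nonzero and of smaller size, so the irreducible minimal
   polynomial cannot divide it and is separable. *)
- rewrite -separable_prod_XsubC -pR -map_poly_ratr_intr separable_map -mE.
  rewrite unlock; apply/idPn => ncop.
  have [m1 mirr'] := mirr.
  have /(_ ncop) := mirr' (gcdp (minpolyQ a) (minpolyQ a)^`()).
  rewrite dvdp_gcdl => /(_ isT)/eqp_dvdl e.
  have : minpolyQ a %| (minpolyQ a)^`() by rewrite -e dvdp_gcdr.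
  have d0 : (minpolyQ a)^`() != 0.
    apply/negP => /eqP d0.
    have := congr1 (fun q : {poly rat} => q`_((size (minpolyQ a)).-2)) d0.
    rewrite coef_deriv coef0.
    rewrite prednK; last by rewrite -subn1 subn_gt0.
    rewrite -lead_coefE (monicP mm) => /eqP.
    by rewrite pnatr_eq0 -subn1 subn_eq0 leqNgt m1.
  move=> /(dvdp_leq d0); rewrite leqNgt lt_size_deriv//.
  by rewrite monic_neq0.
- by move=> x /mapP[z zcs ->]; have := apos z zcs; rewrite ltcE => /andP[].
- rewrite -csR -root_prod_XsubC -csE; exact: ma.
- have [n0|n0] := eqVneq (size xs) 0%N.
    by rewrite n0 mulr0; move/size0nil: n0 => ->; rewrite big_nil.
  have -> : trbar a = ((\sum_(x <- xs) x) / (size xs)%:R)%:C.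
    rewrite /trbar -/cs csR big_map size_map.
    by rewrite rmorphM/= fmorphV/= rmorph_nat rmorph_sum.
  by rewrite /= divfK// pnatr_eq0.
- move=> G Ga x xxs; apply/negP => /eqP Gx.
  have [_ [_ pirr] _] := mpa.
  have mG : ~~ coprimep (minpolyQ a) (ZtoQ G).
    apply/negP; rewrite -(coprimep_map (ratr : rat -> R)) => /coprimep_root.
    rewrite !map_poly_ratr_intr mE map_poly_ratr_intr => /(_ x).
    rewrite Gx eqxx pR root_prod_XsubC => /(_ xxs); exact.
  have /(_ mG) := pirr (gcdp (minpolyQ a) (ZtoQ G)).
  rewrite dvdp_gcdl => /(_ isT)/eqp_dvdl e.
  have : minpolyQ a %| ZtoQ G by rewrite -e dvdp_gcdr.
  move=> /dvdpP[s sE]; move/negP: Ga; apply.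
  by rewrite -map_poly_ratr_intr sE rmorphM rootM ma orbT.
Qed.

End minpoly.

Lemma real_rooted_split (R : realType) (Q : {poly int}) : Q != 0 -> real_rooted R Q ->
  exists (lc : R) (bs : seq R), 1 <= `|lc| /\
    map_poly intr Q = lc *: \prod_(b <- bs) ('X - b%:P) :> {poly R}.
Proof.
move=> Q0 Qr.
have [zs zE] := closed_field_poly_normal (map_poly intr Q : {poly R[i]}).
have lE : lead_coef (map_poly intr Q : {poly R[i]}) = (lead_coef Q)%:~R.
  by rewrite lead_coef_map_inj//; exact: intr_inj.
have l0 : lead_coef Q != 0 by rewrite lead_coef_eq0.
have zR z : z \in zs -> z = (complex.Re z)%:C.
  move=> zzs; rewrite RRe_real//; apply: Qr.
  by rewrite zE lE rootZ ?intr_eq0// root_prod_XsubC.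
exists (lead_coef Q)%:~R, (map (@complex.Re R) zs); split.
  by rewrite -intr_norm ler1z -gtz0_ge1 normr_gt0.
apply: (map_inj_poly (f := real_complex R)) => //; first exact: complexI.
rewrite map_poly_real_complex_intr zE lE map_polyZ/= rmorph_int; congr (_ *: _).
rewrite big_map rmorph_prod/= big_seq [RHS]big_seq.
by apply: eq_bigr => z /zR zE'; rewrite rmorphB/= map_polyX map_polyC/= -zE'.
Qed.

(** * Squarefree products of minimal polynomials of small mean trace *)

Section family.
Context (R : realType).

Lemma limn_einf_lt_often (u : nat -> \bar R) (l : \bar R) (N : nat) :
  (limn_einf u < l)%E -> exists2 k, (N <= k)%N & (u k < l)%E.
Proof.
move=> ul; apply: contrapT => nk; move: ul; apply/negP; rewrite -leNgt.
apply: (@le_trans _ _ (einfs u N)).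
  apply: le_ereal_inf_tmp => _ [k /= Nk <-]; rewrite leNgt; apply/negP => ukl.
  by apply: nk; exists k.
rewrite limn_einf_lim (cvg_lim _ (@cvg_einfs_sup _ u))//.
by apply: ereal_sup_ubound; exists N.
Qed.

(** An infinite [S] supplies [size p] distinct indices, one more than the number of roots that [p]
    can have. *)
Lemma often_not_root (F : idomainType) (e : nat -> F) (S : set nat) (p : {poly F}) :
  injective e -> (forall N : nat, exists2 k, (N <= k)%N & S k) -> p != 0 ->
  exists2 k, S k & ~~ root p (e k).
Proof.
move=> eI So p0; apply: contrapT => nk.
have rt k : S k -> root p (e k).
  by move=> Sk; apply/negPn/negP => r; apply: nk; exists k.
have [ks [ksz ksu ksS]] : exists ks : seq nat,
    [/\ size ks = size p, uniq ks & forall k, k \in ks -> S k].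
  elim: (size p) => [|m [ks [ksz ksu ksS]]]; first by exists [::].
  have [k mk Sk] := So (\max_(i <- ks) i).+1.
  exists (k :: ks); split; first by rewrite /= ksz.
    rewrite /= ksu andbT; apply/negP => kks.
    by move: mk; rewrite ltnNge leq_bigmax_seq.
  by move=> i; rewrite inE => /predU1P[->//|/ksS].
have : (size [seq e k | k <- ks] < size p)%N.
  apply: max_poly_roots => //; last by rewrite map_inj_uniq.
  by apply/allP => _ /mapP[k /ksS kS ->]; exact: rt.
by rewrite size_map ksz ltnn.
Qed.

(** Each induction step multiplies by the minimal polynomial of some [e k] of mean trace below [T]
    that is not a root of [G]. The factor [p] of [G] makes the new roots distinct from the old ones;
    the other factors keep them off the zeros of the [Q]. *)
Lemma squarefree_totally_positive (As : seq {poly int}) (e : nat -> R[i]) (T : R)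
    (m : nat) :
  (forall Q, Q \in As -> Q != 0) ->
  is_enumeration (@totally_positive R) e ->
  (limn_einf (fun k => (complex.Re (trbar (e k)))%:E) < T%:E)%E ->
  exists (p : {poly int}) (xs : seq R),
  [/\ p != 0, map_poly intr p = \prod_(x <- xs) ('X - x%:P),
     uniq xs & forall x, x \in xs -> 0 < x] /\
  [/\ (m <= size xs)%N, \sum_(x <- xs) x <= T * (size xs)%:R &
     forall Q, Q \in As -> forall x, x \in xs -> (map_poly intr Q).[x] != 0].
Proof.
move=> A0 [efun einj _] uT.
have eI : injective e by move=> i j; apply: einj; rewrite inE.
elim: m => [|m [p [xs [[p0 pE xu x0] [mx sx Qx]]]]].
  exists 1, [::]; split; split=> //; first exact: oner_neq0.
    by rewrite rmorph1 big_nil.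
  by rewrite big_nil mulr0.
pose G := p * \prod_(Q <- As) Q.
have G0 : map_poly intr G != 0 :> {poly R[i]}.
  rewrite -size_poly_eq0 size_map_inj_poly//; last exact: intr_inj.
  rewrite size_poly_eq0 mulf_neq0// prodf_seq_neq0.
  by apply/allP => Q /A0.
have [k kT] := often_not_root eI
  (fun N => limn_einf_lt_often N uT) G0.
rewrite rmorphM rootM negb_or => /andP[pk Qk].
have [q [ys [[qm qE yu y0] [kys ytr yG]]]] := totally_positive_roots (efun k I).
have yp := yG p pk.
have yQ Q : Q \in As -> forall x, x \in ys -> (map_poly intr Q).[x] != 0.
  move=> QA; apply: yG; apply: contra Qk => rQ.
  rewrite rmorph_prod/= (perm_big _ (perm_to_rem QA))/= big_cons rootM rQ.
  by [].
exists (q * p), (ys ++ xs); split; split.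
- by rewrite mulf_neq0// monic_neq0.
- by rewrite rmorphM/= qE pE big_cat.
- rewrite cat_uniq yu xu andbT/=; apply/hasPn => x xxs; apply/negP => /yp.
  by rewrite pE -rootE root_prod_XsubC xxs.
- by move=> x; rewrite mem_cat => /orP[/y0|/x0].
- rewrite size_cat -addn1 addnC leq_add//.
  by case: (ys) kys.
- rewrite big_cat/= size_cat natrD mulrDr lerD// -ytr ler_wpM2r//.
  by move: kT; rewrite lte_fin => /ltW.
- move=> Q QA x; rewrite mem_cat => /orP[/(yQ Q QA)//|/(Qx Q QA)//].
Qed.

End family.

(** * Logarithmic potentials of uniform measures and mixtures *)

(** The summands are the bounds later obtained for the mutual energies of the smeared points, with
    [D] for the diagonal. The logarithms have nonnegative total and are dropped; the distances are
    at most [x i + x j], whose mean over all pairs is at most [2 * T]. *)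
Lemma sum_kernel_le (R : realType) (n : nat) (x : 'I_n -> R) (T c D eta : R) :
  (forall i, 0 < x i)%R -> (\sum_i x i <= T * n%:R)%R -> (0 <= eta)%R ->
  (0 <= \sum_i \sum_(j | j != i) ln `|x i - x j|)%R ->
  (0 <= D)%R ->
  (\sum_i \sum_j (c + (if j == i then D
      else 4 * eta * (`|x i - x j| + 1) - (1 + eta) ^+ 2 * ln `|x i - x j|)) <=
   n%:R ^+ 2 * (c + 4 * eta * (2 * T + 1)) + n%:R * D)%R.
Proof.
move=> x0 xT eta0 E0 D0; set F := fun i j => ln `|x i - x j|.
apply: (@le_trans _ _ (\sum_i \sum_j (c + 4 * eta * (x i + x j + 1)) +
   \sum_i (D - (1 + eta) ^+ 2 * (\sum_(j | j != i) F i j)))%R).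
  rewrite -big_split/=; apply: ler_sum => i _.
  rewrite mulr_sumr -sumrN [X in _ <= _ + (D + X)]big_mkcond/=.
  rewrite [X in _ <= _ + (X + _)](_ : D = \sum_j (if j == i then D else 0)); last first.
    by rewrite -big_mkcond big_pred1_eq.
  rewrite -!big_split/=; apply: ler_sum => j _.
  (* The first double sum includes a diagonal term that the left side lacks; it is nonnegative. *)
  have [->|ji] /= := eqVneq j i.
    have : 0 <= 4 * eta * (x i + x i + 1).
      by rewrite !mulr_ge0// ?addr_ge0// ltW.
    lra.
  have : 4 * eta * (`|x i - x j| + 1) <= 4 * eta * (x i + x j + 1).
    rewrite ler_wpM2l ?mulr_ge0// lerD2r.
    by apply: le_trans (ler_normB _ _) _; rewrite !gtr0_norm.
  rewrite -/(F i j); lra.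
have -> : (\sum_i \sum_j (c + 4 * eta * (x i + x j + 1)) =
    n%:R ^+ 2 * (c + 4 * eta) + 8 * eta * n%:R * \sum_i x i)%R.
  have cst (a : R) : \sum_(j < n) a = n%:R * a.
    by rewrite sumr_const card_ord mulr_natl.
  under eq_bigr => i _.
    rewrite big_split/= cst -mulr_sumr !big_split/= !cst.
    over.
  rewrite big_split/= cst -mulr_sumr !big_split/= -mulr_sumr !cst.
  by move: (\sum_i x i) n%:R => S m; ring.
rewrite sumrB sumr_const card_ord -mulr_sumr -[(D *+ n)%R]mulr_natl.
have h1 : (0 <= (1 + eta) ^+ 2 * \sum_i \sum_(j | j != i) F i j)%R.
  by rewrite mulr_ge0// exprn_ge0// addr_ge0.
have h2 : (8 * eta * n%:R * \sum_i x i <= 8 * eta * n%:R * (T * n%:R))%R.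
  by rewrite ler_wpM2l// !mulr_ge0.
have -> : n%:R ^+ 2 * (c + 4 * eta * (2 * T + 1)) =
    n%:R ^+ 2 * (c + 4 * eta) + 8 * eta * n%:R * (T * n%:R) by ring.
rewrite -!addrA lerD2l; apply: lerD => //.
by rewrite gerDl oppr_le0.
Qed.

Section measures.
Local Open Scope ereal_scope.

Lemma mixture_exists d (T : measurableType d) (R : realType) (n : nat)
    (w : nat -> R) (P : nat -> probability T R) :
  (forall k, 0 <= w k)%R -> (\sum_(k < n) w k = 1)%R ->
  exists mu : probability T R, forall f : T -> \bar R,
    measurable_fun setT f -> (forall x, 0 <= f x) ->
    \int[mu]_x f x = \sum_(k < n) (w k)%:E * \int[P k]_x f x.
Proof.
move=> w0 w1.
pose m : {measure set T -> \bar R} :=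
  msum (fun k => mscale (NngNum (w0 k)) (P k) : {measure set T -> \bar R}) n.
have mT : m setT = 1.
  rewrite -w1 -sumEFin; apply: eq_bigr => k _.
  by rewrite -[RHS]mule1 -(probability_setT (P k)).
exists (mnormalize m (P 0%N)) => f mf f0.
transitivity (\int[m]_x f x).
  apply: eq_measure_integral => A _ _ /=.
  by rewrite /mnormalize mT onee_eq0/= invr1 mule1.
rewrite /m ge0_integral_measure_sum//.
by apply: eq_bigr => k _; rewrite ge0_integral_mscale.
Qed.

(** The level [c] will be chosen with [expR c] above all distances among the roots involved, where
    the cutoff at 0 is inactive. *)
Definition neglog (R : realType) (c u : R) : \bar R :=
  maxe 0 (c%:E - lne u%:E).

(** * The truncated logarithmic kernel *)

Section neglog.
Context (R : realType).
Implicit Types (c : R).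

Lemma neglog_ge0 c (u : R) : 0 <= neglog c u.
Proof. by rewrite /neglog le_max lexx. Qed.

Lemma neglogE c (u : R) : (0 < u)%R -> (ln u <= c)%R -> neglog c u = (c - ln u)%:E.
Proof.
move=> u0 uc; rewrite /neglog lne_EFin// -EFinB.
by apply: max_r; rewrite lee_fin subr_ge0.
Qed.

Lemma neglog0 c : neglog c 0%R = +oo.
Proof. by rewrite /neglog le0_lneNy//= max_r// leey. Qed.

Lemma neglog_le c (u v : R) :
  (0 <= v)%R -> c%:E - lne u%:E <= v%:E -> neglog c u <= v%:E.
Proof. by move=> v0 cv; rewrite /neglog ge_max lee_fin v0. Qed.

Lemma measurable_lne (d : measure_display) (T : measurableType d) (u : T -> R) :
  measurable_fun setT u -> measurable_fun setT (fun x => lne (u x)%:E).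
Proof.
move=> mu /=; apply: measurable_fun_ifT => //=.
  exact: measurable_fun_ler.
by apply/measurable_EFinP; apply: measurableT_comp => //; exact: measurable_ln.
Qed.

Lemma measurable_neglog (d : measure_display) (T : measurableType d) c (u : T -> R) :
  measurable_fun setT u -> measurable_fun setT (fun x => neglog c (u x)).
Proof.
move=> mu; apply: measurable_maxe => //; apply: emeasurable_funB => //.
exact: measurable_lne.
Qed.

(* Truncating above at [c] reduces lower bounds for integrals of logarithms to
   upper bounds for integrals of nonnegative functions, for which no
   integrability has to be checked. *)
Lemma integral_ge0_of_truncation (d : measure_display) (T : measurableType d)
    (P : probability T R) (f : T -> \bar R) c :
  measurable_fun setT f -> \int[P]_x maxe 0 (c%:E - f x) <= c%:E ->
  0 <= \int[P]_x f x.
Proof.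
move=> mf gc; pose g x := maxe 0 (c%:E - f x).
have mg : measurable_fun setT g.
  by apply: measurable_maxe => //; exact: emeasurable_funB.
have g0 x : 0 <= g x by rewrite /g le_max lexx.
have ig : P.-integrable setT g.
  apply/integrableP; split=> //.
  under eq_integral do rewrite gee0_abs//.
  exact: le_lt_trans gc (ltry _).
have ic : P.-integrable setT (cst c%:E).
  by apply: finite_measure_integrable_cst.
have icg : P.-integrable setT (fun x => c%:E - g x) by exact: integrableB.
have : 0 <= \int[P]_x (c%:E - g x).
  rewrite integralB// integral_cst//= probability_setT mule1.
  by rewrite subre_ge0.
move=> /le_trans; apply.
have lef x : c%:E - g x <= f x.
  rewrite /g; case: (f x) => [r| |]; first 1 last.
  - by rewrite leey.
  - by rewrite max_r ?leey.
  rewrite -EFinB -EFin_max -EFinB lee_fin.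
  have : (c - r <= Num.max 0 (c - r))%R by rewrite le_max lexx orbT.
  by lra.
(* Since [f] may fail to be integrable, the positive and negative parts are compared separately. *)
rewrite integralE [leRHS]integralE.
have mcg : measurable_fun setT (fun x => c%:E - g x) by case/integrableP: icg.
apply: leeB; apply: ge0_le_integral => //.
- exact: measurable_funepos.
- exact: measurable_funepos.
- by move=> x _; rewrite !funeposE le_max2.
- exact: measurable_funeneg.
- exact: measurable_funeneg.
- by move=> x _; rewrite !funenegE le_max2// leeN2.
Qed.

(** A dyadic layer-cake bound. Put [u = |x - v|]. If [0 < u < d], every natural [k] up to
    [ln (d / u)] satisfies [2 ^ k <= expR k <= d / u], so the series counts more than [ln (d / u)]
    intervals. If [u = 0], it counts all of them. *)
Lemma neglog_le_series (v d c x : R) : (0 < d)%R -> (ln d <= c)%R ->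
  neglog c `|x - v|%R <= (c - ln d)%:E +
    \sum_(k <oo) (\1_(`[(v - d / (2 ^ k)%:R)%R, (v + d / (2 ^ k)%:R)%R]) x)%:E.
Proof.
move=> d0 dc.
pose B k := `[(v - d / (2 ^ k)%:R)%R, (v + d / (2 ^ k)%:R)%R]%classic.
set S := \sum_(k <oo) _.
have S_ge (n : nat) : (forall k : nat, (k < n)%N -> B k x) -> n%:R%:E <= S.
  move=> nB; rewrite [leLHS](_ : _ = \sum_(0 <= k < n) (\1_(B k) x : R)%:E).
    by apply: nneseries_lim_ge => k _ _; rewrite lee_fin.
  rewrite big_mkord -[in LHS](card_ord n) -sum1_card natr_sum -sumEFin.
  by apply: eq_bigr => k _; rewrite indicE mem_set//; apply: nB.
have S0 : 0 <= S by apply: (S_ge 0%N).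
have BE k : B k x = (`|x - v| <= d / (2 ^ k)%:R)%R :> Prop.
  by rewrite /B /= in_itv/= -ler_distlC distrC.
have [xv|xv] := eqVneq (`|x - v|)%R 0%R.
  rewrite xv neglog0.
  suff -> : S = +oo by rewrite addeC.
  apply/eq_infty => r.
  have [r0|r0] := leP 0%R r; last by apply: le_trans S0; rewrite lee_fin ltW.
  apply: (@le_trans _ _ (Num.truncn r).+1%:R%:E).
    by rewrite lee_fin ltW// truncnS_gt.
  by apply: S_ge => k _; rewrite BE xv divr_ge0// ltW.
have u0 : (0 < `|x - v|)%R by rewrite lt_neqAle eq_sym xv normr_ge0.
set u := (`|x - v|)%R in u0 BE *.
have [du|ud] := leP d u.
  apply: (@le_trans _ _ (c - ln d)%:E); last by rewrite leeDl.
  apply: neglog_le; first by rewrite subr_ge0.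
  by rewrite lne_EFin// -EFinB lee_fin lerB// ler_ln// posrE.
have l0 : (0 <= ln d - ln u)%R by rewrite subr_ge0 ler_ln ?posrE// ltW.
apply: (@le_trans _ _ ((c - ln d) + (Num.truncn (ln d - ln u)).+1%:R)%:E); last first.
  rewrite EFinD leeD2l//; apply: S_ge => k; rewrite ltnS => kn.
  have {kn} kl : (k%:R <= ln d - ln u)%R.
    by rewrite -truncn_ge_nat.
  rewrite BE ler_pdivlMr ?ltr0n ?expn_gt0// mulrC -ler_pdivlMr//.
  rewrite -[leRHS]lnK ?posrE ?divr_gt0// ln_div ?posrE//.
  apply: (@le_trans _ _ (expR k%:R)); last by rewrite ler_expR.
  rewrite -[k%:R]mulr1 expRM_natl natrX lerXn2r ?nnegrE ?expR_ge0//.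
  by apply: le_trans (expR_ge1Dx 1).
apply: neglog_le; first by rewrite addr_ge0// subr_ge0.
rewrite lne_EFin// -EFinB lee_fin.
have : (ln d - ln u < (Num.truncn (ln d - ln u)).+1%:R)%R by exact: truncnS_gt.
lra.
Qed.

(** Integrates [neglog_le_series] term by term; the constant 8 is the sum of the series
    [4 / 2 ^ k]. *)
Lemma integral_neglog_le_of_itv (P : probability (measurableTypeR R) R) (v d c : R) :
  (0 < d)%R -> (ln d <= c)%R ->
  (forall k, P `[(v - d / (2 ^ k)%:R)%R, (v + d / (2 ^ k)%:R)%R]%classic
             <= (4 / (2 ^ k)%:R)%:E) ->
  \int[P]_x neglog c `|x - v|%R <= (c - ln d + 8)%:E.
Proof.
move=> d0 dc PB.
pose B k := `[(v - d / (2 ^ k)%:R)%R, (v + d / (2 ^ k)%:R)%R]%classic.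
have mS : measurable_fun setT
    (fun x : measurableTypeR R => \sum_(k <oo) (\1_(B k) x : R)%:E).
  have m1 k : xpredT k ->
      measurable_fun setT (fun x : measurableTypeR R => (\1_(B k) x : R)%:E).
    move=> _; apply/measurable_EFinP; apply: measurable_indic.
    exact: measurable_itv.
  have p1 k (x : measurableTypeR R) :
      setT x -> xpredT k -> 0 <= (\1_(B k) x : R)%:E.
    by move=> _ _; rewrite lee_fin.
  exact: (ge0_emeasurable_sum p1 m1).
apply: (@le_trans _ _
    (\int[P]_x ((c - ln d)%:E + \sum_(k <oo) (\1_(B k) x : R)%:E))).
  apply: ge0_le_integral => //.
  - by move=> x _; exact: neglog_ge0.
  - apply: measurable_neglog; apply: measurableT_comp => //.
    exact: measurable_funB.
  - exact: emeasurable_funD.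
  - by move=> x _; exact: neglog_le_series.
rewrite ge0_integralD//; last 2 first.
  by move=> x _; rewrite lee_fin subr_ge0.
  by move=> x _; exact: nneseries_ge0.
rewrite integral_cst//= probability_setT mule1 [leRHS]EFinD leeD2l//.
rewrite integral_nneseries//; last first.
  by move=> k; apply/measurable_EFinP; apply: measurable_indic; exact: measurable_itv.
apply: le_trans (@epsilon_trick0 R 8 xpredT _) => //.
apply: lee_nneseries => [k _ _|k _].
  by apply: integral_ge0 => x _; rewrite lee_fin.
rewrite integral_indic//; last exact: measurable_itv.
rewrite setIT (le_trans (PB k))// lee_fin.
rewrite expnS natrM invfM mulrA.
have -> : (8 / 2 = 4 :> R)%R by lra.
by [].
Qed.

End neglog.

(** * Truncated potentials of uniform measures *)

Section uniform.
Context (R : realType).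
Implicit Types (a l y c v rho : R).

Lemma unif_lt a l : (0 < l -> a < a + l)%R.
Proof. by move=> l0; rewrite ltrDl. Qed.

Definition unif a l (l0 : (0 < l)%R) : probability (measurableTypeR R) R :=
  uniform_prob (unif_lt a l0).

Lemma measurable_neglog_dist c v :
  measurable_fun setT (fun x : measurableTypeR R => neglog c `|x - v|%R).
Proof.
by apply: measurable_neglog; apply: measurableT_comp => //; exact: measurable_funB.
Qed.

Lemma unif_le a l (l0 : (0 < l)%R) (f g : measurableTypeR R -> \bar R) :
  measurable_fun setT f -> measurable_fun setT g ->
  (forall x, 0 <= f x) -> (forall x, 0 <= g x) ->
  (forall x, (a <= x <= a + l)%R -> f x <= g x) ->
  \int[unif a l0]_x f x <= \int[unif a l0]_x g x.
Proof.
move=> mf mg f0 g0 fg; rewrite !integral_uniform//.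
apply: lee_wpmul2l; first by rewrite lee_fin invr_ge0; lra.
apply: ge0_le_integral => //; exact: measurable_funTS.
Qed.

Lemma unif_itv_le a l (l0 : (0 < l)%R) v rho : (0 <= rho)%R ->
  unif a l0 `[(v - rho)%R, (v + rho)%R]%classic <= (2 * rho / l)%:E.
Proof.
move=> rho0; rewrite /unif /= /uniform_prob integral_uniform_pdf.
set I := _ `&` _.
have mI : measurable I by exact: measurableI.
rewrite (eq_integral (fun=> (l^-1)%:E)); last first.
  move=> x; rewrite inE => -[_ /=]; rewrite in_itv/= /uniform_pdf => ->.
  by rewrite addrAC subrr add0r.
rewrite integral_cst//= mulrC EFinM.
apply: lee_wpmul2l; first by rewrite lee_fin invr_ge0 ltW.
apply: (@le_trans _ _ (lebesgue_measure `[(v - rho)%R, (v + rho)%R]%classic)).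
  by apply: le_measure; rewrite ?inE//; exact: subIsetl.
rewrite lebesgue_measure_itv/= lte_fin -EFinB.
by case: ifPn => _; rewrite lee_fin; lra.
Qed.

Lemma unif_disjoint a l (l0 : (0 < l)%R) (A : set R) :
  (forall x, A x -> ~ (a <= x <= a + l)%R) -> unif a l0 A = 0.
Proof.
move=> disj; rewrite /unif /= /uniform_prob integral_uniform_pdf.
rewrite (_ : _ `&` _ = set0) ?integral_set0//.
by apply/seteqP; split => // x [Ax /=]; rewrite in_itv/=; exact: disj.
Qed.

(** The case [d = l] of the dyadic bound, uniform in [v]. It serves the diagonal terms and the
    measure on [[M, 2M]]. *)
Lemma unif_neglog_le_len a l (l0 : (0 < l)%R) c v : (ln l <= c)%R ->
  \int[unif a l0]_x neglog c `|x - v|%R <= (c - ln l + 8)%:E.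
Proof.
move=> lc; apply: integral_neglog_le_of_itv => // k.
apply: le_trans (unif_itv_le _ _ _ _) _; first by rewrite divr_ge0// ltW.
have p0 : (0 < (2 ^ k)%:R :> R)%R by rewrite ltr0n expn_gt0.
rewrite lee_fin ler_pdivrMr// mulrAC mulrA ler_pM2r ?invr_gt0//.
by rewrite ler_pM2r//; lra.
Qed.

(** The dyadic bound with [d = |a - v|]. For [k >= 1], either [l < d / 2] and the support misses the
    interval around [v], or [d <= 2 * l] and the density bound suffices. For [k = 0] the bound 4
    exceeds the total mass. *)
Lemma unif_neglog_le_dist a l (l0 : (0 < l)%R) c v :
  a != v -> (ln `|a - v| <= c)%R ->
  \int[unif a l0]_x neglog c `|x - v|%R <= (c - ln `|a - v| + 8)%:E.
Proof.
move=> av dc; have d0 : (0 < `|a - v|)%R by rewrite normr_gt0 subr_eq0.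
apply: integral_neglog_le_of_itv => // -[|k].
  apply: (@le_trans _ _ 1); last by rewrite lee_fin expn0 divr1; lra.
  by apply: probability_le1; exact: measurable_itv.
set d : R := (`|a - v|)%R in d0 dc *.
have p0 : (0 < (2 ^ k.+1)%:R :> R)%R by rewrite ltr0n expn_gt0.
have pE : ((2 ^ k.+1)%:R = 2 * (2 ^ k)%:R :> R)%R by rewrite expnS natrM.
have p1 : (1 <= (2 ^ k)%:R :> R)%R by rewrite ler1n expn_gt0.
set p := (2 ^ k.+1)%:R%R in p0 pE *.
have dp : (d / p <= d / 2)%R.
  by rewrite ler_pM2l// lef_pV2 ?posrE//; lra.
have [ld|dl] := ltP l (d / 2)%R.
  rewrite unif_disjoint; first by rewrite lee_fin divr_ge0// ltW.
  move=> x; rewrite /= in_itv/= -ler_distlC => xv axl.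
  have : (d <= `|a - x| + `|v - x|)%R.
    by rewrite /d (_ : a - v = (a - x) - (v - x))%R ?ler_normB//; lra.
  have : (`|a - x| <= l)%R by rewrite ler_norml; lra.
  lra.
apply: le_trans (unif_itv_le _ _ _ _) _; first by rewrite divr_ge0// ltW.
rewrite lee_fin ler_pdivrMr// mulrAC mulrA ler_pM2r ?invr_gt0//.
lra.
Qed.

(* Averaging [log |x - v|] over a short interval starting at [a] costs at most
   [eta (log^- |a - v| + |a - v| + 1)]: the loss is [O(l / |a - v|)] when [v] is far from
   [a] and bounded otherwise, and a bounded loss is negligible with respect
   to [eta * log (1 / |a - v|)] when [v] is close to [a]. *)
Lemma unif_neglog_le eta a l (l0 : (0 < l)%R) c v :
  (0 < eta <= 1)%R -> (l <= expR (- (8 / eta)) * (1 - expR (- eta)))%R ->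
  (`|a - v| <= expR c)%R ->
  \int[unif a l0]_x neglog c `|x - v|%R + (eta * c)%:E <=
  (1 + eta)%:E * neglog c `|a - v|%R + (eta * `|a - v| + eta)%:E.
Proof.
move=> /andP[eta0 eta1] lE dc.
have [->|av] := eqVneq a v.
  rewrite subrr normr0 neglog0 gt0_muley; last by rewrite lte_fin; lra.
  by rewrite addye ?leey// ; case: (_ \is _).
have d0 : (0 < `|a - v|)%R by rewrite normr_gt0 subr_eq0.
have ldc : (ln `|a - v| <= c)%R by rewrite -(expRK c) ler_ln ?posrE ?expR_gt0.
rewrite (neglogE d0 ldc).
have lnd := ln_sublinear d0.
set d : R := (`|a - v|)%R in d0 dc ldc lnd *.
set s := expR (- (8 / eta)) in lE.
have s0 : (0 < s)%R by exact: expR_gt0.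
rewrite -EFinM -EFinD.
(* The term [eta * c] cancels on both sides, leaving [eta * (d - ln d + 1)] to pay for the loss. If
   [d < s], then [- eta * ln d > 8] covers the constant of [unif_neglog_le_dist]. *)
have [ds|sd] := ltP d s.
  rewrite (@le_trans _ _ ((c - ln d + 8) + eta * c)%:E)//.
    by rewrite EFinD leeD2r//; exact: unif_neglog_le_dist.
  rewrite lee_fin.
  have : (ln d < - (8 / eta))%R by rewrite -[ltRHS]expRK ltr_ln ?posrE.
  rewrite -mulNr ltr_pdivlMr//.
  have : (0 <= eta * d)%R by rewrite mulr_ge0// ltW.
  nra.
(* Now [l] is so small relative to [d] that all points of the interval stay at distance at least
   [d * expR (- eta)] from [v]: the loss is at most [eta]. *)
have e1 : (expR (- eta) < 1)%R by rewrite expR_lt1; lra.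
have ld : (l <= d * (1 - expR (- eta)))%R.
  by apply: le_trans lE _; rewrite ler_pM2r// subr_gt0.
rewrite (@le_trans _ _ ((c - ln d + eta) + eta * c)%:E)//; last first.
  rewrite lee_fin.
  have : (0 <= eta * (d - ln d))%R by rewrite mulr_ge0 ?subr_ge0// ltW.
  nra.
rewrite EFinD leeD2r//.
have -> : (c - ln d + eta)%:E = \int[unif a l0]_x (c - ln d + eta)%:E.
  by rewrite integral_cst//= probability_setT mule1.
apply: unif_le => //.
- exact: measurable_neglog_dist.
- by move=> x; exact: neglog_ge0.
- by move=> x; rewrite lee_fin; lra.
move=> x axl.
have xd : (d * expR (- eta) <= `|x - v|)%R.
  have : (d <= `|x - v| + `|x - a|)%R.
    by rewrite /d (_ : a - v = (x - v) - (x - a))%R ?ler_normB//; lra.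
  have : (`|x - a| <= l)%R by rewrite ler_norml; lra.
  by move: ld; rewrite mulrBr mulr1; lra.
have xv0 : (0 < `|x - v|)%R by apply: lt_le_trans xd; rewrite mulr_gt0 ?expR_gt0.
apply: neglog_le; first lra.
rewrite lne_EFin// -EFinB lee_fin.
have : (ln (d * expR (- eta)) <= ln `|x - v|)%R.
  by rewrite ler_ln ?posrE ?mulr_gt0 ?expR_gt0.
by rewrite lnM ?posrE ?expR_gt0// expRK; lra.
Qed.

End uniform.

(** * Truncated potentials and mutual energies *)

Section potential.
Context (R : realType).
Local Notation PR := (probability (measurableTypeR R) R).
Implicit Types (P Q mu nu : PR) (c eta t T : R).

Definition potential c Q (v : measurableTypeR R) : \bar R :=
  \int[Q]_x neglog c `|x - v|%R.

Definition mutual_energy c P Q : \bar R := \int[P]_v potential c Q v.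

Lemma measurable_neglog_dist2 c :
  measurable_fun setT (fun z : measurableTypeR R * measurableTypeR R =>
    neglog c `|z.2 - z.1|%R).
Proof.
apply: measurable_neglog; apply: measurableT_comp => //.
exact: measurable_funB.
Qed.

Lemma measurable_potential c Q : measurable_fun setT (potential c Q).
Proof.
exact: (measurable_fun_fubini_tonelli_F _ (measurable_neglog_dist2 c)
  (fun=> neglog_ge0 _ _)).
Qed.

Lemma potential_ge0 c Q v : 0 <= potential c Q v.
Proof. by apply: integral_ge0 => x _; exact: neglog_ge0. Qed.

Lemma mutual_energyC c P Q : mutual_energy c P Q = mutual_energy c Q P.
Proof.
rewrite /mutual_energy /potential.
rewrite (fubini_tonelli _ (measurable_neglog_dist2 c) (fun=> neglog_ge0 _ _))/=.
by apply: eq_integral => x _; apply: eq_integral => y _; rewrite distrC.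
Qed.

Lemma log_energy_ge0 c mu : mutual_energy c mu mu <= c%:E -> 0 <= log_energy mu.
Proof.
move=> muc; apply: (@integral_ge0_of_truncation _ _ _ (mu \x mu)%E _ c).
  apply: measurable_lne; apply: measurableT_comp => //.
  exact: measurable_funB.
rewrite (eq_integral (fun z : measurableTypeR R * measurableTypeR R =>
    neglog c `|z.2 - z.1|%R)); last by move=> z _; rewrite distrC.
by rewrite (fubini_tonelli1 _ (measurable_neglog_dist2 c) (fun=> neglog_ge0 _ _)).
Qed.

(** Applies [unif_neglog_le] twice, first smearing [a] and then [b], whence the square of [1 + eta].
    The added 1 in the hypothesis on [c] allows for points of [[b, b + r]], which lie within
    [|a - b| + 1] of [a]. *)
Lemma mutual_energy_unif_le eta a b r (r0 : (0 < r)%R) c :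
  (0 < eta <= 1)%R -> (r <= expR (- (8 / eta)) * (1 - expR (- eta)))%R ->
  (r <= 1)%R -> (0 <= c)%R -> a != b -> (`|a - b| + 1 <= expR c)%R ->
  mutual_energy c (unif b r0) (unif a r0) <=
  (c - (1 + eta) ^+ 2 * ln `|a - b| + 4 * eta * (`|a - b| + 1))%:E.
Proof.
move=> eta01 rE r1 c0 ab dc; have /andP[eta0 eta1] := eta01.
have d0 : (0 < `|a - b|)%R by rewrite normr_gt0 subr_eq0.
set d : R := (`|a - b|)%R in dc d0 *.
have ldc : (ln d <= c)%R.
  by rewrite -(expRK c) ler_ln ?posrE ?expR_gt0// (le_trans _ dc)// lerDl.
pose X := \int[unif b r0]_v neglog c `|v - a|%R.
have X0 : 0 <= X by apply: integral_ge0 => x _; exact: neglog_ge0.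
have XE : X <= ((1 + eta) * (c - ln d) + (eta * d + eta) - eta * c)%:E.
  rewrite EFinB leeBrDr//.
  have := @unif_neglog_le _ eta b _ r0 c a eta01 rE.
  rewrite distrC -/d neglogE//; apply.
  by rewrite (le_trans _ dc)// lerDl.
have JX : mutual_energy c (unif b r0) (unif a r0) + (eta * c)%:E <=
    (1 + eta)%:E * X + (eta * (d + 1) + eta)%:E.
  have -> : (eta * c)%:E = \int[unif b r0]_v (eta * c)%:E.
    by rewrite integral_cst//= probability_setT mule1.
  have -> : (eta * (d + 1) + eta)%:E = \int[unif b r0]_v (eta * (d + 1) + eta)%:E.
    by rewrite integral_cst//= probability_setT mule1.
  have ec0 : (0 <= eta * c)%R by rewrite mulr_ge0// ltW.
  have ed0 : (0 <= eta * (d + 1) + eta)%R.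
    by rewrite addr_ge0 ?mulr_ge0 ?addr_ge0// ltW.
  rewrite /mutual_energy -ge0_integralD//; last 2 first.
    by move=> x _; exact: potential_ge0.
    exact: measurable_potential.
  have e0 : 0 <= (1 + eta)%:E by rewrite lee_fin; lra.
  have -> : (1 + eta)%:E * X = \int[unif b r0]_v ((1 + eta)%:E * neglog c `|v - a|%R).
    rewrite ge0_integralZl//; first exact: measurable_neglog_dist.
    by move=> x _; exact: neglog_ge0.
  have mz : measurable_fun setT
      (fun x : measurableTypeR R => (1 + eta)%:E * neglog c `|x - a|%R).
    by apply: measurable_funeM; exact: measurable_neglog_dist.
  rewrite -ge0_integralD//; last first.
    by move=> x _; rewrite mule_ge0// neglog_ge0.
  apply: unif_le => //.
  - apply: emeasurable_funD => //; exact: measurable_potential.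
  - exact: emeasurable_funD.
  - by move=> x; rewrite adde_ge0 ?potential_ge0.
  - by move=> x; rewrite adde_ge0 ?mule_ge0 ?neglog_ge0.
  move=> v bv.
  have vd : (`|a - v| <= d + 1)%R.
    have : (`|a - v| <= d + `|b - v|)%R.
      by rewrite /d (_ : a - v = (a - b) + (b - v))%R ?ler_normD//; lra.
    have : (`|b - v| <= r)%R by rewrite ler_norml; lra.
    lra.
  apply: (le_trans (unif_neglog_le _ eta01 rE _)); first lra.
  rewrite [X in _ * neglog _ X]distrC leeD2l// lee_fin lerD2r ler_pM2l//.
have XF : X \is a fin_num.
  by rewrite ge0_fin_numE//; apply: le_lt_trans XE _; exact: ltry.
move: XE JX; rewrite -(fineK XF); set x : R := fine X.
rewrite lee_fin -EFinM -EFinD -leeBrDr// -EFinB => xE /le_trans; apply.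
rewrite lee_fin.
(* The multiples of [c] add up to exactly [c], and the errors [(1 + eta) * eta * (d + 1) + eta * (d
   + 2)] are at most [4 * eta * (d + 1)] since [eta <= 1]. *)
have : ((1 + eta) * x <=
    (1 + eta) * ((1 + eta) * (c - ln d) + (eta * d + eta) - eta * c))%R.
  by rewrite ler_pM2l//; lra.
have : (0 <= eta * d * (1 - eta))%R by rewrite !mulr_ge0// ?subr_ge0// ltW.
have : (0 <= eta * (1 - eta))%R by rewrite !mulr_ge0// ?subr_ge0// ltW.
have : (0 <= eta * d)%R by rewrite mulr_ge0// ltW.
nra.
Qed.

End potential.

(** * Mixtures of probability measures *)

Section mixture.
Context (R : realType).
Local Notation PR := (probability (measurableTypeR R) R).
Implicit Types (mu nu : PR) (c eta t T : R).

Definition mixture_of (n : nat) t (U : 'I_n -> PR) nu mu :=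
  forall f : measurableTypeR R -> \bar R,
    measurable_fun setT f -> (forall x, 0 <= f x) ->
    \int[mu]_x f x =
      \sum_(k < n) ((1 - t) / n%:R)%:E * \int[U k]_x f x + t%:E * \int[nu]_x f x.

Lemma mixture_of_exists (n : nat) t (U : 'I_n -> PR) nu :
  (0 <= t <= 1)%R -> (0 < n)%N -> exists mu, mixture_of t U nu mu.
Proof.
move=> /andP[t0 t1] n0.
(* The indices below [n] carry the measures [U k], and the index [n] carries [nu]. *)
pose w (k : nat) : R := (if (k < n)%N then (1 - t) / n%:R else t)%R.
pose P (k : nat) : PR := oapp U nu (insub k).
have [||mu muE] := @mixture_exists _ _ R n.+1 w P.
- by move=> k; rewrite /w; case: ifP => // _; rewrite divr_ge0 ?subr_ge0.
- rewrite big_ord_recr/= /w ltnn.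
  under eq_bigr do rewrite ltn_ord.
  rewrite sumr_const card_ord -[X in (X + _)%R]mulr_natr.
  by rewrite divfK ?pnatr_eq0 -?lt0n// subrK.
exists mu => f mf f0; rewrite muE// big_ord_recr/= /w ltnn.
rewrite /P insubF ?ltnn//=; congr (_ + _).
by apply: eq_bigr => k _; rewrite ltn_ord valK.
Qed.

Lemma mixture_le (n : nat) t (U : 'I_n -> PR) nu mu (B : 'I_n -> R) (b : R)
    (f : measurableTypeR R -> \bar R) :
  (0 <= t <= 1)%R -> mixture_of t U nu mu ->
  measurable_fun setT f -> (forall x, 0 <= f x) ->
  (forall k, \int[U k]_x f x <= (B k)%:E) -> \int[nu]_x f x <= b%:E ->
  \int[mu]_x f x <= ((1 - t) / n%:R * (\sum_(k < n) B k) + t * b)%:E.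
Proof.
move=> /andP[t0 t1] muE mf f0 UB nub; rewrite muE// EFinD.
apply: leeD; last by rewrite EFinM; apply: lee_wpmul2l; rewrite ?lee_fin.
rewrite mulr_sumr -sumEFin; apply: lee_sum => k _.
rewrite [leRHS]EFinM; apply: lee_wpmul2l => //.
by rewrite lee_fin divr_ge0// subr_ge0.
Qed.

End mixture.

(** * Admissible measures of small mean *)

Section near_optimal.
Context (R : realType).
Local Notation PR := (probability (measurableTypeR R) R).

(** The positive part of a sum is at most the sum of the positive parts; at a root the right side is
    [+oo]. *)
Lemma truncated_log_poly_le (lc c x : R) (s : seq R) : lc != 0%R ->
  maxe 0 ((ln `|lc| + (size s)%:R * c)%:E -
     lne `|lc * \prod_(b <- s) (x - b)|%R%:E) <=
  \sum_(b <- s) neglog c `|x - b|%R.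
Proof.
move=> lc0; have N0 : 0 <= \sum_(b <- s) neglog c `|x - b|%R.
  by apply: sume_ge0 => b _; exact: neglog_ge0.
rewrite ge_max N0 andTb.
have [xs|xs] := boolP (x \in s).
  rewrite [leRHS](_ : _ = +oo) ?leey//.
  apply/esum_eqyP.
    by move=> b _; rewrite gt_eqF// (lt_le_trans _ (neglog_ge0 _ _))// ltNye.
  by exists x; split=> //; rewrite subrr normr0 neglog0.
have xb b : b \in s -> (x - b != 0)%R.
  by move=> bs; rewrite subr_eq0; apply: contraNneq xs => ->.
have p0 : (\prod_(b <- s) (x - b) != 0)%R.
  by rewrite prodf_seq_neq0; apply/allP => b bs; rewrite xb.
rewrite lne_EFin ?normr_gt0 ?mulf_neq0// normrM lnM ?posrE ?normr_gt0//.
rewrite ln_norm_prod// -EFinB.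
apply: (@le_trans _ _ (\sum_(b <- s) (c - ln `|x - b|)%:E)).
  rewrite sumEFin lee_fin sumrB big_const_seq count_predT iter_addr_0 -mulr_natl.
  by lra.
apply: lee_sum => b _; have [->|xb0] := eqVneq (x - b)%R 0%R.
  by rewrite normr0 neglog0 leey.
by rewrite /neglog lne_EFin ?normr_gt0// -EFinB le_max lexx orbT.
Qed.

(** Per root of [Q], smearing costs at most [t] on average, with weight [1 - t], while [nu] gains at
    least 1 with weight [t]; the gain wins. *)
Lemma log_integral_mixture_ge0 (n : nat) (x : 'I_n -> R) (r : R) (r0 : (0 < r)%R)
    (T t eta c lc : R) (bs : seq R) (nu mu : PR) (Q : {poly int}) :
  (0 < n)%N -> (0 < eta <= t)%R -> (t <= 1)%R ->
  (r <= expR (- (8 / eta)) * (1 - expR (- eta)))%R ->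
  mixture_of t (fun i => unif (x i) r0) nu mu ->
  (forall v, potential c nu v <= (c - 1)%:E) ->
  (map_poly intr Q = lc *: \prod_(b <- bs) ('X - b%:P) :> {poly R})%R ->
  (1 <= `|lc|)%R ->
  (forall i b, b \in bs -> x i != b /\ `|x i - b| <= expR c)%R ->
  (forall i, 0 < x i)%R -> (\sum_i x i <= T * n%:R)%R ->
  (forall b, b \in bs -> eta * (T + `|b| + 1) <= t)%R ->
  (0 <= \sum_i ln `|(map_poly intr Q).[x i]|)%R ->
  0 <= log_integral mu Q.
Proof.
move=> n0 /andP[eta0 etat] t1 rE muE nuc QE lc1 xb x0 xT bt Q0.
have t0 : (0 < t)%R by exact: lt_le_trans etat.
have eta_ge0 := ltW eta0.
have eta01 : (0 < eta <= 1)%R by rewrite eta0 (le_trans etat).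
have t01 : (0 <= t <= 1)%R by rewrite ltW.
have lc0 : lc != 0%R by rewrite -normr_gt0; lra.
have hE y : (map_poly intr Q).[y] = (lc * \prod_(b <- bs) (y - b))%R.
  rewrite QE hornerZ horner_prod; congr (_ * _)%R.
  by apply: eq_bigr => b _; rewrite hornerXsubC.
have mQ : measurable_fun setT (fun y : measurableTypeR R => (map_poly intr Q).[y] : R).
  under eq_fun do rewrite hE.
  apply: measurable_funM => //; apply: measurable_prod => b _.
  exact: measurable_funB.
set m := (size bs)%:R%R : R.
apply: (@integral_ge0_of_truncation _ _ _ _ _ (ln `|lc| + m * c)%R).
  by apply: measurable_lne; exact: measurableT_comp mQ.
have mneg : measurable_fun setT
    (fun y : measurableTypeR R => \sum_(b <- bs) neglog c `|y - b|%R).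
  by apply: emeasurable_sum => b; exact: measurable_neglog_dist.
apply: (@le_trans _ _ (\int[mu]_y \sum_(b <- bs) neglog c `|y - b|%R)).
  apply: ge0_le_integral => //.
  - by move=> y _; rewrite le_max lexx.
  - apply: measurable_maxe => //; apply: emeasurable_funB => //.
    by apply: measurable_lne; exact: measurableT_comp mQ.
  - by move=> y _; rewrite hE; exact: truncated_log_poly_le.
have intE (P : PR) : \int[P]_y \sum_(b <- bs) neglog c `|y - b|%R =
    \sum_(b <- bs) potential c P b.
  rewrite ge0_integral_sum//.
    by move=> b; exact: measurable_neglog_dist.
  by move=> b y _; exact: neglog_ge0.
apply: (@le_trans _ _ ((1 - t) / n%:R * (\sum_i \sum_(b <- bs)
    (c - (1 + eta) * ln `|x i - b| + eta * (`|x i - b| + 1))) +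
    t * (m * (c - 1)))%:E).
  apply: (mixture_le t01 muE mneg).
  - by move=> y; apply: sume_ge0 => b _; exact: neglog_ge0.
  - move=> i; rewrite intE -sumEFin big_seq [leRHS]big_seq; apply: lee_sum => b bbs.
    have [xbi dc] := xb i b bbs.
    have d0 : (0 < `|x i - b|)%R by rewrite normr_gt0 subr_eq0.
    have := unif_neglog_le r0 eta01 rE dc; rewrite neglogE//; last first.
      by rewrite -(expRK c) ler_ln ?posrE ?expR_gt0.
    rewrite -EFinM -EFinD -leeBrDr// -EFinB => /le_trans; apply.
    by rewrite lee_fin; lra.
  - rewrite intE; apply: (@le_trans _ _ (\sum_(b <- bs) (c - 1)%:E)).
      by apply: lee_sum => b _.
    by rewrite sumEFin lee_fin big_const_seq count_predT iter_addr_0 -mulr_natl.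
rewrite lee_fin.
set L := (\sum_i \sum_(b <- bs) ln `|x i - b|)%R.
have nR : (0 < n%:R :> R)%R by rewrite ltr0n.
have l0 : (0 <= ln `|lc|)%R by rewrite ln_ge0.
have cst (a : R) : (\sum_(b <- bs) a = m * a)%R.
  by rewrite big_const_seq count_predT iter_addr_0 -mulr_natl.
have cstn (a : R) : (\sum_(i < n) a = n%:R * a)%R.
  by rewrite sumr_const card_ord mulr_natl.
(* The hypothesis [Q0], with [Q] split into its leading coefficient and its roots. *)
have LE : (0 <= n%:R * ln `|lc| + L)%R.
  rewrite -cstn -big_split/=; apply: le_trans Q0 _.
  apply: ler_sum => i _; rewrite hE normrM.
  have xb0 b : b \in bs -> (x i - b != 0)%R.
    by move=> /(xb i)[+ _]; rewrite subr_eq0.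
  rewrite lnM ?posrE ?normr_gt0//; first by rewrite ln_norm_prod.
  by rewrite prodf_seq_neq0; apply/allP => b bbs; rewrite xb0.
have DE : (eta * \sum_i \sum_(b <- bs) (`|x i - b| + 1) <= n%:R * (m * t))%R.
  rewrite exchange_big/= mulr_sumr -cst mulr_sumr big_seq [leRHS]big_seq.
  apply: ler_sum => b bbs; apply: (@le_trans _ _ (eta * \sum_i (x i + `|b| + 1))%R).
    rewrite ler_wpM2l//; apply: ler_sum => i _; rewrite lerD2r.
    by apply: le_trans (ler_normB _ _) _; rewrite gtr0_norm.
  rewrite 2!big_split/= !cstn.
  apply: (@le_trans _ _ (eta * (T * n%:R + n%:R * `|b| + n%:R * 1)))%R.
    by rewrite ler_wpM2l// !lerD2r.
  rewrite (_ : _ * _ = n%:R * (eta * (T + `|b| + 1)))%R; last by ring.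
  by rewrite ler_wpM2l ?ler0n// bt.
have -> : (\sum_i \sum_(b <- bs)
    (c - (1 + eta) * ln `|x i - b| + eta * (`|x i - b| + 1)) =
    n%:R * (m * c) - (1 + eta) * L +
    eta * \sum_i \sum_(b <- bs) (`|x i - b| + 1))%R.
  under eq_bigr => i _.
    rewrite big_split/= sumrB cst -!mulr_sumr.
    over.
  by rewrite big_split/= sumrB cstn -!mulr_sumr.
move: LE DE; set D := (eta * _)%R; move: L D => L D LE DE.
have m0 : (0 <= m)%R by rewrite ler0n.
have : ((1 - t) / n%:R * (n%:R * (m * c) - (1 + eta) * L + D) <=
    (1 - t) * (m * c + (1 + eta) * ln `|lc| + m * t))%R.
  rewrite -mulrA ler_wpM2l ?subr_ge0// mulrC ler_pdivrMr//.
  have : (0 <= (1 + eta) * (n%:R * ln `|lc| + L))%R.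
    by rewrite mulr_ge0//; lra.
  lra.
(* Since [eta <= t], the coefficient of [ln |lc|] is at most 1. The remaining error is
   [(1 - t) * m * t - t * m = - m * t * t]. *)
have : (0 <= (1 - (1 - t) * (1 + eta)) * ln `|lc|)%R.
  apply: mulr_ge0 => //.
  have : (0 <= t * eta)%R by rewrite mulr_ge0// ltW.
  lra.
have : (0 <= m * t * t)%R by rewrite !mulr_ge0// ltW.
lra.
Qed.

Lemma mutual_energy_le_of_potential (c b : R) (P nu : PR) :
  (forall v, potential c nu v <= b%:E) -> mutual_energy c P nu <= b%:E.
Proof.
move=> nub; apply: (@le_trans _ _ (\int[P]_v b%:E)).
  apply: ge0_le_integral => //.
  - by move=> v _; exact: potential_ge0.
  - exact: measurable_potential.
by rewrite integral_cst//= probability_setT mule1.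
Qed.

(** By bilinearity: pairs of smeared points have mean energy at most [c + t], and every pairing with
    [nu] is at most [c - 1]. *)
Lemma mutual_energy_mixture_le (n : nat) (x : 'I_n -> R) (r : R) (r0 : (0 < r)%R)
    (T t eta c : R) (nu mu : PR) :
  (0 < n)%N -> (0 < eta <= t)%R -> (t <= 1)%R ->
  (r <= expR (- (8 / eta)) * (1 - expR (- eta)))%R -> (r <= 1)%R ->
  mixture_of t (fun i => unif (x i) r0) nu mu ->
  (0 <= c)%R -> (forall v, potential c nu v <= (c - 1)%:E) ->
  (forall i j, `|x i - x j| + 1 <= expR c)%R -> injective x ->
  (forall i, 0 < x i)%R -> (\sum_i x i <= T * n%:R)%R ->
  (8 * eta * (2 * T + 1) <= t)%R -> (2 * (8 - ln r) <= t * n%:R)%R ->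
  (0 <= \sum_i \sum_(j | j != i) ln `|x i - x j|)%R ->
  mutual_energy c mu mu <= c%:E.
Proof.
move=> n0 /andP[eta0 etat] t1 rE r1 muE c0 nuc dc xI x0 xT etaT tn E0.
have t0 : (0 < t)%R by exact: lt_le_trans etat.
have eta_ge0 := ltW eta0.
have eta01 : (0 < eta <= 1)%R by rewrite eta0 (le_trans etat).
have t01 : (0 <= t <= 1)%R by rewrite ltW.
have lr : (ln r <= 0)%R by rewrite ln_le0.
have nR : (0 < n%:R :> R)%R by rewrite ltr0n.
set D : R := (8 - ln r)%R.
have D0 : (0 <= D)%R by rewrite /D; lra.
pose K i j : R := (c + (if j == i then D else
  4 * eta * (`|x i - x j| + 1) - (1 + eta) ^+ 2 * ln `|x i - x j|))%R.
have KE i j : mutual_energy c (unif (x j) r0) (unif (x i) r0) <= (K i j)%:E.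
  rewrite /K; have [->|ji] := eqVneq j i.
    apply: mutual_energy_le_of_potential => v.
    rewrite /D [(c + _)%R](_ : _ = c - ln r + 8)%R; last by ring.
    by apply: unif_neglog_le_len; exact: le_trans lr c0.
  rewrite [(c + _)%R](_ : _ = c - (1 + eta) ^+ 2 * ln `|x i - x j| +
    4 * eta * (`|x i - x j| + 1))%R; last by ring.
  apply: mutual_energy_unif_le => //.
  by apply: contraNneq ji => /xI ->.
apply: (@le_trans _ _ ((1 - t) / n%:R * (\sum_i
    ((1 - t) / n%:R * (\sum_j K i j) + t * (c - 1))) + t * (c - 1))%:E).
  apply: (mixture_le t01 muE).
  - exact: measurable_potential.
  - exact: potential_ge0.
  (* Symmetry makes [mu] the outer measure again, so that [mixture_le] applies a second time. *)
  - move=> i; rewrite -/(mutual_energy c _ mu) mutual_energyC.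
    apply: (mixture_le t01 muE).
    + exact: measurable_potential.
    + exact: potential_ge0.
    + by move=> j; exact: KE.
    + rewrite -/(mutual_energy c nu _) mutual_energyC.
      exact: mutual_energy_le_of_potential.
  - rewrite -/(mutual_energy c nu mu) mutual_energyC.
    exact: mutual_energy_le_of_potential.
rewrite lee_fin big_split/= -mulr_sumr sumr_const card_ord -mulr_natl.
have := @sum_kernel_le _ n x T c D eta x0 xT eta_ge0 E0 D0.
rewrite -/(\sum_i \sum_j K i j)%R; move: (\sum_i \sum_j K i j)%R => S SE.
(* One [t / 2] comes from the choice of [eta], the other from [D / n] for large [n]. *)
have hS : (S / n%:R <= (c + t) * n%:R)%R.
  rewrite ler_pdivrMr//; apply: le_trans SE _.
  rewrite [leRHS](_ : _ = n%:R ^+ 2 * (c + t))%R; last by ring.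
  have : (n%:R ^+ 2 * (c + 4 * eta * (2 * T + 1)) <= n%:R ^+ 2 * (c + t / 2))%R.
    by rewrite ler_wpM2l ?exprn_ge0 ?ler0n//; lra.
  have : (n%:R * D <= n%:R * (t * n%:R / 2))%R.
    by rewrite ler_wpM2l ?ler0n// /D; lra.
  lra.
(* After this bound the total is at most [c - t - t * t * (1 - t)]. *)
have : ((1 - t) / n%:R * ((1 - t) / n%:R * S + n%:R * (t * (c - 1))) <=
  (1 - t) * ((1 - t) * (c + t) + t * (c - 1)))%R.
  rewrite -mulrA ler_wpM2l ?subr_ge0// mulrC ler_pdivrMr//.
  have : ((1 - t) * (S / n%:R) <= (1 - t) * ((c + t) * n%:R))%R.
    by rewrite ler_wpM2l ?subr_ge0.
  lra.
have : (0 <= t * t)%R by rewrite mulr_ge0 // ltW.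
have : (0 <= t * t * (1 - t))%R by rewrite !mulr_ge0 ?subr_ge0// ltW.
lra.
Qed.

(** The parameters [eta] and [r] depend only on [t], [T] and [Bd], so [N] can be fixed before the
    points; only the level [c] depends on the points. *)
Lemma near_optimal_exists (A : set {poly int}) (Bd T t : R) :
  (0 < t <= 1)%R -> (0 <= T)%R ->
  (forall Q, A Q -> exists lc bs, [/\ (1 <= `|lc|)%R,
     (map_poly intr Q = lc *: \prod_(b <- bs) ('X - b%:P) :> {poly R})%R &
     forall b, b \in bs -> (`|b| <= Bd)%R]) ->
  exists N : nat, forall n (x : 'I_n -> R), (N <= n)%N -> injective x ->
  (forall i, 0 < x i)%R -> (\sum_i x i <= T * n%:R)%R ->
  (0 <= \sum_i \sum_(j | j != i) ln `|x i - x j|)%R ->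
  (forall Q, A Q -> (forall i, (map_poly intr Q).[x i] != 0)%R /\
     (0 <= \sum_i ln `|(map_poly intr Q).[x i]|)%R) ->
  exists mu : PR, admissible A mu /\
    \int[mu]_x x%:E <= (T + t * (1 + 2 * expR 9))%:E.
Proof.
move=> /andP[t0 t1] T0 AE.
pose B := Num.max Bd 0%R.
have B0 : (0 <= B)%R by rewrite le_max lexx orbT.
(* Small enough for [eta <= t], [8 * eta * (2 * T + 1) <= t] and [eta * (T + |b| + 1) <= t]
   together. *)
pose eta : R := (t / (8 * (2 * T + B + 2)))%R.
have den0 : (0 < 8 * (2 * T + B + 2))%R by lra.
have etaE : (eta * (8 * (2 * T + B + 2)) = t)%R by rewrite divfK// gt_eqF.
have eta0 : (0 < eta)%R by rewrite divr_gt0.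
have eB0 : (0 <= eta * B)%R by rewrite mulr_ge0// ltW.
have eT0 : (0 <= eta * T)%R by rewrite mulr_ge0// ltW.
have etat : (eta <= t)%R by lra.
pose r : R := (expR (- (8 / eta)) * (1 - expR (- eta)))%R.
have e1 : (expR (- eta) < 1)%R by rewrite expR_lt1; lra.
have r0 : (0 < r)%R by rewrite mulr_gt0 ?expR_gt0 ?subr_gt0.
have rt : (r <= t)%R.
  have h1 : (r <= 1 - expR (- eta))%R.
    have : (expR (- (8 / eta)) <= 1)%R.
      by rewrite -expR0 ler_expR oppr_le0 divr_ge0// ltW.
    by apply: ler_piMl; rewrite subr_ge0 ltW.
  have := expR_ge1Dx (- eta); lra.
have r1 : (r <= 1)%R by exact: le_trans t1.
have lr : (ln r <= 0)%R by rewrite ln_le0.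
exists (Num.truncn (2 * (8 - ln r) / t)).+1 => n x Nn xI x0 xT E0 AQ.
have n0 : (0 < n)%N by exact: leq_trans Nn.
have tn : (2 * (8 - ln r) <= t * n%:R)%R.
  rewrite [leRHS]mulrC -ler_pdivrMr//; apply: ltW; apply: lt_le_trans (truncnS_gt _) _.
  by rewrite ler_nat.
(* The value 9 exceeds by 1 the constant 8 of [unif_neglog_le_len], so the truncated potential of
   [nu] is at most [c - 1]. *)
have lnM9 : (ln (expR 9) = 9 :> R)%R by rewrite expRK.
have M0 : (0 < expR 9 :> R)%R by exact: expR_gt0.
move: (expR 9) lnM9 M0 => M lnM M0.
pose nu : PR := unif M M0.
have t01 : (0 <= t <= 1)%R by rewrite (ltW t0).
have [mu muE] := mixture_of_exists (fun i => unif (x i) r0) nu t01 n0.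
pose S := (\sum_i x i)%R.
have xS i : (x i <= S)%R.
  by rewrite /S (bigD1 i)//= lerDl sumr_ge0// => j _; exact: ltW.
have S0 : (0 <= S)%R by rewrite sumr_ge0// => j _; exact: ltW.
(* At least [ln M], and large enough that [expR c >= 1 + c] dominates the distances between the
   points, increased by 1, and those from the points to the roots of the [Q]. *)
pose c := (9 + S + B)%R.
have cE : (1 + c <= expR c)%R by exact: expR_ge1Dx.
have nuc v : potential c nu v <= (c - 1)%:E.
  apply: le_trans (unif_neglog_le_len _ _ _ _) _.
    by rewrite lnM /c; lra.
  by rewrite lnM lee_fin; lra.
exists mu; split; first split.
- have mN : measurable (~` `[0%R, +oo[%classic : set (measurableTypeR R)).
    by apply: measurableC; exact: measurable_itv.
  have muN : mu (~` `[0%R, +oo[%classic) = 0.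
    apply/eqP; rewrite eq_le measure_ge0 andbT.
    have -> : mu (~` `[0%R, +oo[%classic) =
        \int[mu]_y (\1_(~` `[0%R, +oo[%classic) y : R)%:E.
      by rewrite integral_indic// setIT.
    rewrite (_ : 0 = ((1 - t) / n%:R * (\sum_(k < n) 0) + t * 0)%:E); last first.
      by rewrite big1// !mulr0 addr0.
    apply: (mixture_le t01 muE) => //.
    + by apply/measurable_EFinP; exact: measurable_indic.
    + move=> k; rewrite integral_indic// setIT [leLHS](_ : _ = 0)//.
      apply: unif_disjoint => y /= /negP; rewrite in_itv/= andbT -ltNge => y0.
      have := x0 k; lra.
    + rewrite integral_indic// setIT [leLHS](_ : _ = 0)//.
      apply: unif_disjoint => y /= /negP; rewrite in_itv/= andbT -ltNge => y0; lra.
  have := probability_setC mu mN; rewrite setCK muN sube0; exact.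
- apply: (@log_energy_ge0 _ c).
  apply: (mutual_energy_mixture_le (eta := eta)
    n0 _ t1 _ r1 muE _ nuc _ xI x0 xT _ tn E0) => //.
  + by rewrite eta0.
  + by rewrite /c; lra.
  + move=> i j; apply: le_trans cE; rewrite /c.
    have : (`|x i - x j| <= S)%R.
      rewrite ler_norml; have := x0 i; have := x0 j.
      by have := xS i; have := xS j; lra.
    lra.
  + lra.
- move=> Q AQ'; have [lc [bs [lc1 QE bsB]]] := AE Q AQ'.
  have [Q0 Qs] := AQ Q AQ'.
  have bB b : b \in bs -> (`|b| <= B)%R by move=> /bsB; rewrite /B le_max => ->.
  apply: (log_integral_mixture_ge0 (r0 := r0) (eta := eta) (T := T)
    n0 _ t1 _ muE nuc QE lc1) => //.
  + by rewrite eta0.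
  + move=> i b bbs; split.
      apply: contraNneq (Q0 i) => ->.
      rewrite QE hornerZ horner_prod (perm_big _ (perm_to_rem bbs))/= big_cons.
      by rewrite hornerXsubC subrr mul0r mulr0.
    apply: le_trans cE; apply: le_trans (ler_normB _ _) _.
    have := bB b bbs; rewrite (gtr0_norm (x0 i)) /c; have := xS i; lra.
  + move=> b bbs; have := bB b bbs => bB'.
    have : (eta * `|b| <= eta * B)%R by rewrite ler_pM2l.
    lra.
(* [mixture_of] only covers nonnegative functions, so the identity is replaced by its positive
   part. *)
- apply: (@le_trans _ _ (\int[mu]_y (Num.max y 0)%:E)).
    rewrite integralE [leRHS](_ : _ =
      \int[mu]_y ((fun y : measurableTypeR R => y%:E) ^\+ y)).
      by rewrite -[leRHS]sube0 leeB//; apply: integral_ge0.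
    by apply: eq_integral => y _; rewrite funeposE EFin_max.
  apply: (@le_trans _ _ ((1 - t) / n%:R * (\sum_i (x i + r)) + t * (2 * M))%:E).
    have mm : measurable_fun setT (fun y : measurableTypeR R => (Num.max y 0)%:E).
      by apply/measurable_EFinP; exact: measurable_maxr.
    have cstE (P : PR) (a : R) : \int[P]_y a%:E = a%:E.
      by rewrite integral_cst//= probability_setT mule1.
    apply: (mixture_le t01 muE) => //.
    + by move=> y; rewrite lee_fin le_max lexx orbT.
    + move=> k; rewrite -(cstE (unif (x k) r0)); apply: unif_le => //.
      * by move=> y; rewrite lee_fin le_max lexx orbT.
      * by move=> y; rewrite lee_fin; have := x0 k; lra.
      * move=> y /andP[? ?]; rewrite lee_fin ge_max; have := x0 k.
        by move=> ?; apply/andP; split; lra.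
    + rewrite -(cstE nu); apply: unif_le => //.
      * by move=> y; rewrite lee_fin le_max lexx orbT.
      * by move=> y; rewrite lee_fin; lra.
      * move=> y /andP[? ?]; rewrite lee_fin ge_max.
        by apply/andP; split; lra.
  rewrite lee_fin big_split/= sumr_const card_ord -mulr_natl.
  have nR : (0 < n%:R :> R)%R by rewrite ltr0n.
  have : ((1 - t) / n%:R * (\sum_i x i + n%:R * r) <= (1 - t) * (T + r))%R.
    rewrite -mulrA ler_wpM2l ?subr_ge0// mulrC ler_pdivrMr//; lra.
  have : (0 <= t * T)%R by rewrite mulr_ge0// ltW.
  have : (0 <= t * r)%R by rewrite mulr_ge0// ltW.
  lra.
Qed.

End near_optimal.

End measures.

(** * Comparison of [lambda] with the liminf *)

Lemma lambda_le_near_optimal (R : realType) (A : set {poly int}) (T t : R)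
    (e : nat -> R[i]) :
  finite_set A -> (forall Q, A Q -> Q != 0) -> (forall Q, A Q -> real_rooted R Q) ->
  is_enumeration (@totally_positive R) e ->
  (liminf_trbar e < T%:E)%E -> 0 < t <= 1 ->
  (lambda R A <= (T + t * (1 + 2 * expR 9))%:E)%E.
Proof.
move=> /finite_seqP[As AE] A0 Ar e_enum eT t01.
have AsA Q : A Q <-> Q \in As by rewrite AE.
have A0' Q : Q \in As -> Q != 0 by move=> /AsA/A0.
have family m := squarefree_totally_positive m A0' e_enum eT.
(* A nonempty family of positive roots has mean at most [T]. *)
have T0 : 0 <= T.
  have [p [xs [[_ _ _ x0] [m1 sx _]]]] := family 1%N.
  have : 0 <= T * (size xs)%:R.
    apply: le_trans sx; rewrite big_seq; apply: sumr_ge0 => x /x0; exact: ltW.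
  by rewrite pmulr_lge0// ltr0n.
have [Bd BdE] : exists Bd : R, forall Q, Q \in As -> exists lc bs,
    [/\ (1 <= `|lc|)%R,
     map_poly intr Q = lc *: \prod_(b <- bs) ('X - b%:P) :> {poly R} &
     forall b, b \in bs -> `|b| <= Bd].
  have Ar' Q : Q \in As -> Q != 0 /\ real_rooted R Q.
    by move=> /AsA AQ; split; [exact: A0|exact: Ar].
  elim: (As) Ar' => [|Q As' IH] Ar'; first by exists 0.
  have [|Bd BdE] := IH.
    by move=> Q' Q'A; apply: Ar'; rewrite inE Q'A orbT.
  have [Q0 Qr] := Ar' Q (mem_head _ _).
  have [lc [bs [lc1 QE]]] := real_rooted_split Q0 Qr.
  exists (Num.max Bd (\sum_(b <- bs) `|b|)) => Q'.
  rewrite inE => /predU1P[->|/BdE[lc' [bs' [? ? bsB]]]].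
    exists lc, bs; split=> // b bbs; rewrite le_max; apply/orP; right.
    by rewrite (perm_big _ (perm_to_rem bbs))/= big_cons lerDl sumr_ge0.
  by exists lc', bs'; split=> // b /bsB bB; rewrite le_max bB.
have [N NE] := near_optimal_exists t01 T0 (fun Q AQ => BdE Q ((AsA Q).1 AQ)).
have [p [xs [[_ pE xu x0] [Nx sx Qx]]]] := family N.
pose x (i : 'I_(size xs)) := nth 0 xs i.
have xin i : x i \in xs by rewrite mem_nth.
have xI : injective x.
  by move=> i j /eqP; rewrite nth_uniq// => /eqP/val_inj.
have {}pE : map_poly intr p = \prod_i ('X - (x i)%:P).
  by rewrite pE (big_nth 0) big_mkord.
have [||||mu [muA mean]] := NE _ x Nx xI.
- by move=> i; exact: x0.
- by move: sx; rewrite (big_nth 0) big_mkord.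
- exact: sum_ln_dist_ge0 pE xI.
- move=> Q /AsA QA; have Q0 i : (map_poly intr Q).[x i] != 0 by exact: Qx.
  by split=> //; exact: sum_ln_horner_ge0 pE xI Q0.
by apply: le_trans mean; apply: ereal_inf_lbound; exists mu.
Qed.

Theorem corollary1p2 (R : realType) (A : set {poly int})
  (A_finite : finite_set A)
  (A_neq0 : forall Q, A Q -> Q != 0)
  (A_real_rooted : forall Q, A Q -> real_rooted R Q)
  (e : nat -> R[i]) (e_enum : is_enumeration (@totally_positive R) e) :
  (lambda R A <= liminf_trbar e)%E.
Proof.
have M0 : 0 < 1 + 2 * expR 9 :> R by have := expR_gt0 (9 : R); lra.
have le_real (T : R) : (liminf_trbar e < T%:E)%E -> (lambda R A <= T%:E)%E.
  move=> eT; apply/lee_addgt0Pr => eps eps0.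
  (* Makes the excess [t * (1 + 2 * expR 9)] at most [eps]. *)
  pose t := Num.min 1 (eps / (1 + 2 * expR 9)).
  have t01 : 0 < t <= 1 by rewrite lt_min ltr01 divr_gt0// ge_min lexx.
  apply: le_trans
    (lambda_le_near_optimal A_finite A_neq0 A_real_rooted e_enum eT t01) _.
  by rewrite -EFinD lee_fin lerD2l -ler_pdivlMr// ge_min lexx orbT.
(* [le_real] needs a real strictly above the liminf: any real if the liminf is [-oo], and [l + eps]
   if it is finite. *)
case l_eq : (liminf_trbar e) => [l| |]; last 2 first.
- exact: leey.
- rewrite leeNy_eq; apply/eqP/eq_ninfty => T.
  by apply: le_real; rewrite l_eq ltNyr.
apply/lee_addgt0Pr => eps eps0; rewrite -EFinD; apply: le_real.
by rewrite l_eq lte_fin ltrDl.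
Qed.
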